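(* Let $(X,T)$ be a t.d.s. such that no proper pair of $(X,T)$ is two-sided asymptotic for $T$, and let $(Y,\sigma)$ be the system constructed from $(X,T)$ as described in the context. Then for any $x,y\in Y$ with $x\neq y$, the pair $(x,y)$ is not two-sided asymptotic for $\sigma$.
   Context: A t.d.s. $(X,T)$ is a compact metric space $X$ with metric $d_X$ together with a homeomorphism $T:X\to X$. A proper pair is $(x,y)$ with $x\neq y$. A pair $(x,y)$ is two-sided asymptotic for $T$ if $\lim_{n\to+\infty}d_X(T^nx,T^ny)=0$ and $\lim_{n\to+\infty}d_X(T^{-n}x,T^{-n}y)=0$. Construction of $(Y,\sigma)$ from a t.d.s. $(X,T)$. Let $X_*=X\cup\{*\}$ with $*\notin X$ an added isolated point: $d_{X_*}$ extends $d_X$ with $d_{X_*}(x,* )=\mathrm{diam}(X)+1$ for $x\in X$; let $T_*:X_*\to X_*$ be $T$ on $X$ and $T_*( * )=*$. Let $X_*^{\mathbb Z}$ have the product topology (and a compatible metric) and let $\sigma((x_i)_i)=(x_{i+1})_i$. Fix a decreasing sequence $(\epsilon_k)_{k\ge0}$ with $0<\epsilon_k<1/2$. Fix integers $n_0<n_1<n_2<\cdots$ and, for each $k\ge 0$, a disjoint union $\{0,1,\dots,n_k-1\}=A_k\cup B_k$ with $0,n_k-1\in B_k$ such that: (i) $2\le\#A_k<n_k\epsilon_k$; (ii) for every integer $0\le i<n_k$ there is $a\in A_k$ with $a+i\in A_k\cup(n_k+A_k)$; (iii) for every integer $0<i\le \frac{n_k}{2}+1$, $\#((A_k+i)\cap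 B_k)\ge\sqrt{n_k/2}-1$ (such choices exist). Put $p_{-1}=1$, $p_k=n_kp_{k-1}$, $b_k=\#B_k$, and let $\tau_k:B_k\to\{0,1,\dots,b_k-1\}$ be the strictly increasing bijection. Define $f_k:B_k\to(-(b_k-2),0]\cap\mathbb Z$ by $f_k(0)=0$, $f_k(n_k-1)=-(b_k-3)$, and $f_k(i)=\tau_k(i)-(b_k-2)$ otherwise. Put $b'_{-1}=1$ and $b'_k=b'_{k-1}\cdot\#f_k(B_k)=b'_{k-1}(b_k-2)$ for $k\ge0$. Define $g_k:B_k\times X_*\to X_*$ by $g_k(i,x)=T_*^{\,b'_{k-1}f_k(i)}x$. Let $Q_k=\{x\in X_*^{\mathbb Z}: x_{ip_{k-1}}=g_k(i,x_0)\ \forall i\in B_k\}$ and $P_k=\{x\in X_*^{\mathbb Z}: x_{ip_{k-1}}=*\ \forall i\in A_k\}$. Let $Y_{-1}=X_*^{\mathbb Z}$, $Y_k=Y_{k-1}\cap\bigcap_{n\in\mathbb Z}\sigma^{np_k}(P_k\cap Q_k)$ for $k\ge0$, and $Y=\bigcap_{k=0}^\infty\bigcup_{r=0}^{p_k-1}\sigma^{-r}Y_k$. $Y$ is closed and $\sigma$-invariant, and $(Y,\sigma)$ denotes the corresponding subsystem of $(X_*^{\mathbb Z},\sigma)$. *)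

(* Defs.v *)
From HB Require Import structures.
From mathcomp Require Import all_boot all_order all_algebra finmap.
From mathcomp Require Import all_classical all_reals all_analysis.

Set Implicit Arguments.
Unset Strict Implicit.
Unset Printing Implicit Defensive.

Import Order.TTheory GRing.Theory Num.Theory.
Import numFieldNormedType.Exports.

Local Open Scope classical_set_scope.
Local Open Scope ring_scope.

(* [f] raised to an integer power, [g] being the inverse of [f]. *)
Definition ziter (M : Type) (f g : M -> M) (m : int) : M -> M :=
  match m with
  | Posz j => iter j f
  | Negz j => iter j.+1 g
  end.

Definition two_sided_asymptotic (R : realType) (M : Type) (d : M -> M -> R)
    (f g : M -> M) (x y : M) : Prop :=
  (d (ziter f g j%:Z x) (ziter f g j%:Z y) @[j --> \oo] --> (0 : R)) /\
  (d (ziter f g (- j%:Z) x) (ziter f g (- j%:Z) y) @[j --> \oo] --> (0 : R)).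

Definition compatible_metric (R : realType) (M : topologicalType)
    (d : M -> M -> R) : Prop :=
  [/\ forall x y, d x y = 0 <-> x = y,
      forall x y, d x y = d y x,
      forall x y z, d x z <= d x y + d y z &
      forall (x : M) (U : set M), nbhs x U <->
        exists2 e : R, 0 < e & [set y | d x y < e] `<=` U].

Record tds (R : realType) := Tds {
  tds_space :> metricType R;
  tds_compact : compact [set: tds_space];
  tds_map : tds_space -> tds_space;
  tds_inv : tds_space -> tds_space;
  tds_mapK : cancel tds_map tds_inv;
  tds_invK : cancel tds_inv tds_map;
  tds_map_continuous : continuous tds_map;
  tds_inv_continuous : continuous tds_inv
}.

Definition diam (R : realType) (X : metricType R) : R :=
  sup [set mdist p.1 p.2 | p in [set: X * X]].

Lemma mdist_le_diam (R : realType) (X : metricType R) (x y : X) :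
  compact [set: X] -> mdist x y <= diam X.
Proof.
move=> cX.
have cd : continuous (mdist x : X -> R).
  move=> a; apply/cvgrPdist_lt => e e0; near=> b.
  have hab : mdist a b < e.
    near: b; exact: (@metricType_numDomainType.cvgr_dist_lt _ _ _ (nbhs a) _ id).
  rewrite ltr_norml; apply/andP; split.
    rewrite ltrBrDr addrC ltrBlDr.
    by rewrite (le_lt_trans (metric_triangle x a b))// ltrD2l.
  rewrite ltrBlDr addrC.
  by rewrite (le_lt_trans (metric_triangle x b a))// ltrD2l metric_sym.
have : compact (mdist x @` [set: X]).
  by apply: continuous_compact => //; exact: continuous_subspaceT.
move=> /compact_bounded/ex_strict_bound_gt0[M M0 hM].
have hb z : mdist x z <= M.
  by apply: (le_trans (ler_norm _)); apply/ltW/hM; exists z.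
apply: sup_upper_bound; last by exists (x, y).
split; first by exists (mdist x y), (x, y).
exists (M + M) => _ [[u v] _ <-] /=.
by rewrite (le_trans (metric_triangle u x v))// lerD// metric_sym.
Unshelve. all: by end_near. Qed.

(* [None] is the added point [*]. *)
Definition Xstar (R : realType) (X : tds R) : Type := option X.

HB.instance Definition _ (R : realType) (X : tds R) :=
  Choice.on (Xstar X).

Definition dstar (R : realType) (X : tds R) (u v : Xstar X) : R :=
  match u, v with
  | Some x, Some y => mdist x y
  | None, None => 0
  | _, _ => diam X + 1
  end.

Section Xstar_metric.
Variables (R : realType) (X : tds R).

Let diam1_gt0 (x : X) : 0 < diam X + 1.
Proof.
rewrite ltr_wpDl// -(mdistxx x); exact/mdist_le_diam/tds_compact.
Qed.

Let dstarxx (u : Xstar X) : dstar u u = 0.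
Proof. by case: u => //= x; exact: mdistxx. Qed.

Let dstar_positivity (u v : Xstar X) : dstar u v = 0 -> u = v.
Proof.
case: u v => [x|] [y|] //=; first by move=> /mdist_positivity ->.
- by move=> h; have := diam1_gt0 x; rewrite h ltxx.
- by move=> h; have := diam1_gt0 y; rewrite h ltxx.
Qed.

Let dstar_sym (u v : Xstar X) : dstar u v = dstar v u.
Proof. by case: u v => [x|] [y|] //=; exact: metric_sym. Qed.

Let dstar_triangle (v u w : Xstar X) :
  dstar u w <= dstar u v + dstar v w.
Proof.
have dm (x y : X) := mdist_le_diam x y (@tds_compact _ X).
case: u v w => [x|] [y|] [z|] //=.
- exact: metric_triangle.
- by rewrite lerDr mdist_ge0.
- rewrite (le_trans (dm x z))// -[leLHS]addr0 lerD//.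
    by rewrite lerDl.
  exact/ltW/diam1_gt0.
- by rewrite addr0.
- by rewrite lerDl mdist_ge0.
- by rewrite addr_ge0// ltW// diam1_gt0.
- by rewrite add0r.
Qed.

HB.instance Definition _ := @isMetric.Build R (Xstar X)
  (@dstar R X) dstarxx dstar_positivity dstar_sym dstar_triangle.

End Xstar_metric.

Record scheme (R : realType) := Scheme {
  eps_ : nat -> R;
  n_ : nat -> nat;
  A_ : nat -> {fset nat};
  B_ : nat -> {fset nat};
  tau_ : nat -> nat -> nat;
  eps_decreasing : forall k, eps_ k.+1 <= eps_ k;
  eps_bounds : forall k, 0 < eps_ k < 1 / 2;
  n_increasing : forall k, (n_ k < n_ k.+1)%N;
  AB_cover : forall k, (A_ k `|` B_ k = [fset i in iota 0 (n_ k)])%fset;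
  AB_disjoint : forall k, [disjoint A_ k & B_ k]%fset;
  B_first : forall k, 0%N \in B_ k;
  B_last : forall k, (n_ k - 1)%N \in B_ k;
  A_card : forall k,
    (2 <= #|` A_ k|)%N /\ (#|` A_ k|)%:R < (n_ k)%:R * eps_ k;
  A_return : forall k i, (i < n_ k)%N ->
    exists2 a, a \in A_ k &
      (a + i)%N \in (A_ k `|` [fset (n_ k + c)%N | c in A_ k])%fset;
  A_shift : forall k i, (0 < i)%N -> i%:R <= (n_ k)%:R / 2 + 1 :> R ->
    Num.sqrt ((n_ k)%:R / 2) - 1 <=
      (#|` ([fset (a + i)%N | a in A_ k] `&` B_ k)%fset|)%:R :> R;
  tau_increasing : forall k,
    {in B_ k &, forall i j, (i < j)%N -> (tau_ k i < tau_ k j)%N};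
  tau_image : forall k,
    ([fset tau_ k i | i in B_ k] = [fset j in iota 0 #|` B_ k|])%fset
}.

Section construction.
Variables (R : realType) (X : tds R) (C : scheme R).

(* Indices are shifted: [p_ k], [b'_ k] and [Y_ k] stand for p_{k-1}, b'_{k-1}
   and Y_{k-1}, so that [p_ 0] is p_{-1}. *)
Fixpoint p_ (k : nat) : nat := if k is j.+1 then (n_ C j * p_ j)%N else 1%N.

Definition b_ (k : nat) : nat := #|` B_ C k|.

Definition f_ (k i : nat) : int :=
  if i == 0%N then 0
  else if i == (n_ C k - 1)%N then - ((b_ k)%:Z - 3)
  else (tau_ C k i)%:Z - ((b_ k)%:Z - 2).

Fixpoint b'_ (k : nat) : nat :=
  if k is j.+1 then (b'_ j * #|` [fset f_ j i | i in B_ C j]%fset|)%N else 1%N.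

Definition Tstar : Xstar X -> Xstar X := omap (@tds_map R X).
Definition Tstar_inv : Xstar X -> Xstar X := omap (@tds_inv R X).

Lemma TstarK : cancel Tstar Tstar_inv.
Proof. by case=> //= x; rewrite tds_mapK. Qed.

Lemma Tstar_invK : cancel Tstar_inv Tstar.
Proof. by case=> //= x; rewrite tds_invK. Qed.

Definition g_ (k i : nat) (x : Xstar X) : Xstar X :=
  ziter Tstar Tstar_inv ((b'_ k)%:Z * f_ k i) x.

(* X_*^Z with the product topology. *)
Definition seqs := {ptws int -> Xstar X}.

Definition sigma (x : seqs) : seqs := fun i => x (i + 1).
Definition sigma_inv (x : seqs) : seqs := fun i => x (i - 1).

Lemma sigmaK : cancel sigma sigma_inv.
Proof. by move=> x; apply/funext => i; rewrite /sigma /sigma_inv subrK. Qed.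

Lemma sigma_invK : cancel sigma_inv sigma.
Proof. by move=> x; apply/funext => i; rewrite /sigma /sigma_inv addrK. Qed.

Definition sigma_pow (m : int) : seqs -> seqs := ziter sigma sigma_inv m.

Definition Q_ (k : nat) : set seqs :=
  [set x | forall i, i \in B_ C k -> x (i * p_ k)%N%:Z = g_ k i (x 0)].

Definition P_ (k : nat) : set seqs :=
  [set x | forall i, i \in A_ C k -> x (i * p_ k)%N%:Z = None].

Fixpoint Y_ (k : nat) : set seqs :=
  if k is j.+1 then
    Y_ j `&` \bigcap_(m in [set: int])
      (sigma_pow (m * (p_ j.+1)%:Z) @` (P_ j `&` Q_ j))
  else setT.

Definition Yset : set seqs :=
  \bigcap_(k in [set: nat]) \bigcup_(r in `I_(p_ k.+1))
    (sigma_pow (- r%:Z) @` Y_ k.+1).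

End construction.

Arguments Yset {R} X C _.

(* Main.v *)
(* Along the nested blocks of x in Y, the *-pattern and all entries of a
   level-k block are determined by its first entry u: the entries are powers
   T^e u, and every e in (-b'_k, 0] occurs.  If x and y are two-sided
   asymptotic, then far away they have the same *-pattern, because * is
   isolated.  A long non-* block has non-* sub-blocks at both ends, one of them
   far from the origin, and (iii) forces the sub-blocks of x and y to be aligned
   there, hence at every level and everywhere.  So if x_t = u and y_t = v are distinct,
   each relative exponent m realised in x by T^m u is realised at the same
   position in y by T^m v.  Let i_k be the digit of t in its level-k block.  If
   f_k(i_k) is extreme for infinitely many k, then it is attained twice, so the
   pair (u, v) recurs arbitrarily far from t, which is impossible.  Otherwise
   the available exponents exhaust Z in both directions and large |m| occur only
   far from t, so that (u, v) is two-sided asymptotic for T. *)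
Require Import Defs.
From HB Require Import structures.
From mathcomp Require Import all_boot all_order all_algebra finmap.
From mathcomp Require Import all_classical all_reals all_analysis.
From mathcomp Require Import zify ring lra.

Import Order.TTheory GRing.Theory Num.Theory.
Import numFieldNormedType.Exports.

Local Open Scope classical_set_scope.
Local Open Scope ring_scope.

(** * Integer powers of a bijection *)

Section integer_iterates.
Context {M : Type} {f g : M -> M}.
Hypotheses (fK : cancel f g) (gK : cancel g f).

Lemma ziter_succ (a : int) (x : M) : ziter f g (a + 1) x = f (ziter f g a x).
Proof.
case: a => [j|[|j]]; first by rewrite -PoszD addn1.
  by rewrite /= gK.
by rewrite NegzE (_ : - j.+2%:Z + 1 = Negz j) ?NegzE /= ?gK//; lia.
Qed.

Lemma ziter_pred (a : int) (x : M) : ziter f g (a - 1) x = g (ziter f g a x).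
Proof. by rewrite -[in RHS](subrK 1 a) ziter_succ fK. Qed.

Lemma ziterD (a b : int) (x : M) :
  ziter f g (a + b) x = ziter f g a (ziter f g b x).
Proof.
elim: a => [|n IH|n IH]; first by rewrite add0r.
  by rewrite -addn1 PoszD addrAC !ziter_succ IH.
by rewrite -addn1 PoszD opprD addrAC !ziter_pred IH.
Qed.

End integer_iterates.

(** * Block structure of the points of [Yset] *)

Section Structure.
Context {R : realType} {X : tds R} {C : scheme R}.
Implicit Types (x y : seqs X) (k : nat) (s t : int).

Local Notation n := (n_ C).
Local Notation A := (A_ C).
Local Notation B := (B_ C).
Local Notation p := (p_ C).
Local Notation b := (b_ C).
Local Notation b' := (b'_ C).
Local Notation f := (f_ C).
Local Notation T e := (ziter (@Tstar R X) (@Tstar_inv R X) e).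

Lemma TD (a c : int) (u : Xstar X) : T (a + c) u = T a (T c u).
Proof. exact: (ziterD (@TstarK R X) (@Tstar_invK R X)). Qed.

Lemma TNone (e : int) : T e None = None.
Proof. by case: e => m /=; elim: m => //= m ->. Qed.

Lemma TSome (e : int) (u : X) :
  T e (Some u) = Some (ziter (@tds_map R X) (@tds_inv R X) e u).
Proof.
case: e => m /=; elim: m => //= m; first by move=> ->.
by rewrite /Tstar_inv => ->.
Qed.

Lemma T_eq_None (e : int) (u : Xstar X) : (T e u = None) <-> (u = None).
Proof. by case: u => [u|]; rewrite ?TSome ?TNone. Qed.

Lemma sigma_powE (m : int) x (j : int) : sigma_pow m x j = x (j + m).
Proof.
rewrite /sigma_pow; elim: m j => [|m IH|m IH] j; first by rewrite addr0.
  rewrite -addn1 PoszD (ziter_succ (@sigma_invK R X)) /sigma IH.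
  by congr x; lia.
rewrite -addn1 PoszD opprD (ziter_pred (@sigmaK R X) (@sigma_invK R X)).
by rewrite /sigma_inv IH; congr x; lia.
Qed.

(* [sigma^s x] lies in the paper's Y_{k-1}. *)
Definition blocks k x s : Prop :=
  forall j, (j < k)%N -> forall (m : int) (i : nat),
  (i \in B j ->
     x (s + m * (p j.+1)%:Z + (i * p j)%N%:Z) =
     g_ C j i (x (s + m * (p j.+1)%:Z))) /\
  (i \in A j -> x (s + m * (p j.+1)%:Z + (i * p j)%N%:Z) = None).

Lemma Y_blocks k x : Y_ C k x -> blocks k x 0.
Proof.
elim: k => [|k IH] //= -[/IH Yk H] j; rewrite ltnS leq_eqVlt => /predU1P[->|jk];
  last exact: Yk.
(* The sign is reversed: [x] is the shift of [z] by [- m] blocks, so [z] reads [x] from position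
   [m * p k.+1] on. *)
move=> m i; have [z [Pz Qz] zx] := H (- m) I.
have xE l : x (l + m * (p k.+1)%:Z) = z l.
  by rewrite -zx sigma_powE mulNr addrK.
rewrite add0r addrC xE -[m * _]add0r xE;  split => [/Qz|/Pz]//.
Qed.

(** Each level has its own offset; the offsets of different levels are not yet related. *)
Lemma Yset_blocks x : Yset X C x ->
  forall k, exists r : int, blocks k.+1 x r.
Proof.
move=> Yx k; have [r _ [z /Y_blocks Yz zx]] := Yx k I; exists r%:Z.
have xE l : x (l + r%:Z) = z l.
  by rewrite -zx sigma_powE addrK.
move=> j jk m i; have := Yz j jk m i; rewrite -!xE !add0r.
by rewrite [r%:Z + _]addrC [_ + r%:Z + _]addrAC.
Qed.

Lemma blocksW {k l : nat} {x s} : (k <= l)%N -> blocks l x s -> blocks k x s.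
Proof. by move=> kl H j jk; apply: H; exact: leq_trans kl. Qed.

Lemma p_dvd {k l : nat} : (k <= l)%N -> (p k %| p l)%N.
Proof.
elim: l => [|l IH]; first by rewrite leqn0 => /eqP ->.
rewrite leq_eqVlt => /predU1P[->//|/IH h] /=; exact: dvdn_mull.
Qed.

Lemma blocks_shift k x s (q : int) :
  blocks k x s -> blocks k x (s + q * (p k)%:Z).
Proof.
move=> H j jk m i; have /dvdnP[c pE] := p_dvd jk.
have -> : s + q * (p k)%:Z + m * (p j.+1)%:Z =
  s + (q * c%:Z + m) * (p j.+1)%:Z by rewrite pE PoszM; ring.
exact: H.
Qed.

(** * Size estimates and the digit functions [tau_] and [f_] *)

Lemma n_gt4 k : (4 < n k)%N.
Proof.
have [cA ltA] := A_card C k; have /andP[e0 e2] := eps_bounds C k.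
have : (2 : R) < (n k)%:R * (1 / 2).
  apply: (le_lt_trans (_ : _ <= (#|` A k|)%:R)); first by rewrite ler_nat.
  apply: (lt_le_trans ltA); apply: ler_wpM2l => //; exact: ltW.
by rewrite mul1r ltr_pdivlMr// -natrM ltr_nat.
Qed.

Lemma mem_AB k i : (i \in A k) || (i \in B k) = (i < n k)%N.
Proof.
have /fsetP/(_ i) := AB_cover C k.
by rewrite in_fsetU => ->; rewrite !inE /= mem_iota.
Qed.

Lemma A_lt {k i : nat} : i \in A k -> (i < n k)%N.
Proof. by rewrite -mem_AB => ->. Qed.

Lemma B_lt {k i : nat} : i \in B k -> (i < n k)%N.
Proof. by rewrite -mem_AB => ->; rewrite orbT. Qed.

Lemma p_gt0 k : (0 < p k)%N.
Proof. by elim: k => //= k IH; rewrite muln_gt0 IH (ltn_trans _ (n_gt4 k)). Qed.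

Lemma p_gt k : (k < p k)%N.
Proof.
elim: k => //= k IH; have := n_gt4 k => h.
rewrite (leq_ltn_trans IH)// -[ltnLHS]mul1n ltn_pmul2r ?p_gt0//.
exact: leq_trans h.
Qed.

Lemma cardsAB k : (#|` A k| + b k = n k)%N.
Proof.
rewrite /b_ -cardfsUI (disjoint_fsetI0 (AB_disjoint C k)) cardfs0 addn0.
by rewrite AB_cover card_fseq undup_id ?iota_uniq// size_iota.
Qed.

(** Since [eps_ k < 1 / 2], the set [A k] fills less than half of the [n k > 4] places. *)
Lemma b_gt2 k : (2 < b k)%N.
Proof.
have := cardsAB k; have := n_gt4 k.
have [_ ltA] := A_card C k; have /andP[e0 e2] := eps_bounds C k.
have : (#|` A k|)%:R < (n k)%:R / 2 :> R.
  apply: (lt_le_trans ltA); apply: ler_wpM2l => //; rewrite -div1r; exact: ltW.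
by rewrite ltr_pdivlMr// -natrM ltr_nat; lia.
Qed.

Lemma tau_lt {k i : nat} : i \in B k -> (tau_ C k i < b k)%N.
Proof.
move=> iB; have : tau_ C k i \in [fset tau_ C k i | i in B k]%fset.
  by apply/imfsetP; exists i.
by rewrite tau_image !inE mem_iota.
Qed.

Lemma tau_onto {k j : nat} : (j < b k)%N -> exists2 i, i \in B k & tau_ C k i = j.
Proof.
move=> jb; have : j \in [fset tau_ C k i | i in B k]%fset.
  by rewrite tau_image !inE mem_iota.
by move=> /imfsetP[i /= iB ->]; exists i.
Qed.

Lemma tau0 k : tau_ C k 0 = 0%N.
Proof.
have b2 := b_gt2 k; have [i iB i0] := @tau_onto k 0 ltac:(lia).
case: (posnP i) => [ie|ipos]; first by rewrite ie in i0.
by have := tau_increasing (B_first C k) iB ipos; rewrite i0.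
Qed.

Lemma tau_last k : tau_ C k (n k - 1)%N = (b k - 1)%N.
Proof.
have b2 := b_gt2 k.
have [i iB i1] := @tau_onto k (b k - 1)%N ltac:(lia).
have [<-//|ne] := eqVneq i (n k - 1)%N.
have := B_lt iB => in'.
have := tau_increasing iB (B_last C k) ltac:(lia).
by have := tau_lt (B_last C k); lia.
Qed.

Lemma f_bounds {k i : nat} : i \in B k -> - ((b k)%:Z - 3) <= f k i <= 0.
Proof.
move=> iB; have b2 := b_gt2 k; rewrite /f_.
case: eqP => [_|i0]; first lia.
case: eqP => [_|i1]; first lia.
have := B_lt iB => in'.
have := tau_increasing (B_first C k) iB ltac:(lia).
have := tau_increasing iB (B_last C k) ltac:(lia).
by rewrite tau_last; lia.
Qed.

(** The index with [tau_] equal to [v + b k - 2] works: this number lies in [1, [b k - 2]], whereas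
    the endpoints have [tau_] equal to 0 and [b k - 1]. *)
Lemma f_onto {k : nat} {v : int} : - ((b k)%:Z - 3) <= v <= 0 ->
  exists i, [/\ i \in B k, i != 0%N, i != (n k - 1)%N & f k i = v].
Proof.
move=> vb; have b2 := b_gt2 k.
have [i iB iv] := @tau_onto k (absz (v + ((b k)%:Z - 2))) ltac:(lia).
have i0 : i != 0%N by apply: contraPneq iv => ->; rewrite tau0; lia.
have i1 : i != (n k - 1)%N.
  by apply: contraPneq iv => ->; rewrite tau_last; lia.
by exists i; split=> //; rewrite /f_ (negPf i0) (negPf i1); lia.
Qed.

(* Each extreme value is taken at an endpoint of [0, n_k) and in the interior. *)
Lemma f_extreme {k i : nat} : i \in B k ->
  (f k i == 0) || (f k i == - ((b k)%:Z - 3)) ->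
  exists i', [/\ i' \in B k, i' != i & f k i' = f k i].
Proof.
move=> iB fe; have [j [jB j0 j1 fj]] := f_onto (f_bounds iB).
have [ij|ij] := eqVneq j i; last by exists j.
subst j; have n4 := n_gt4 k.
case/orP: fe => /eqP fe; rewrite fe.
  by exists 0%N; split=> //; [exact: B_first|rewrite eq_sym].
exists (n k - 1)%N; split=> //; [exact: B_last|by rewrite eq_sym|].
by rewrite /f_ eqxx; case: eqP => //; lia.
Qed.

(** The values of [f k] are exactly the [b k - 2] integers from [- (b k - 3)] to 0, so [b'] is a
    product of radices. *)
Lemma b'S k : b' k.+1 = (b' k * (b k - 2))%N.
Proof.
rewrite /=; congr muln; have b2 := b_gt2 k.
have -> : [fset f k i | i in B k]%fset =
    [fset - j%:Z | j in [fset j in iota 0 (b k - 2)]]%fset.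
  apply/fsetP => v; apply/imfsetP/imfsetP => /=.
    move=> [i iB ->]; exists `|f k i|%N; have := f_bounds iB.
      by rewrite !inE mem_iota; lia.
    by lia.
  move=> [j]; rewrite !inE mem_iota => jb ->.
  by have [i [iB _ _ <-]] := @f_onto k (- j%:Z) ltac:(lia); exists i.
rewrite card_imfset /=; last by move=> i j /oppr_inj [].
by rewrite card_fseq undup_id ?iota_uniq// size_iota.
Qed.

Lemma b'_gt0 k : (0 < b' k)%N.
Proof. by elim: k => // k IH; rewrite b'S muln_gt0 IH; have := b_gt2 k; lia. Qed.

(** As [n k > 4], the lower bound in [A_shift] is positive, so the intersection is non-empty. *)
Lemma A_meets_B {k i : nat} : (0 < i)%N -> (i.*2 <= n k + 2)%N ->
  exists2 c, c \in A k & (c + i)%N \in B k.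
Proof.
move=> i0 i2; have n4 := n_gt4 k.
have : i%:R <= (n k)%:R / 2 + 1 :> R.
  have : (i.*2)%:R <= (n k + 2)%:R :> R by rewrite ler_nat.
  by rewrite -muln2 natrM natrD; lra.
move=> /(A_shift i0) h.
have : 0 < (#|` ([fset (a + i)%N | a in A k] `&` B k)%fset|)%:R :> R.
  apply: lt_le_trans h; rewrite subr_gt0 -[ltLHS]sqrtr1 ltr_sqrt; last first.
    by rewrite divr_gt0// ltr0n; lia.
  by rewrite ltr_pdivlMr// mul1r ltr_nat; lia.
rewrite ltr0n cardfs_gt0 => /fset0Pn[_ /fsetIP[/imfsetP[c /= cA ->] cB]].
by exists c.
Qed.

(** * Stars inside blocks and alignment of block decompositions *)

Lemma blocks_sub {k x s} (i : nat) :
  blocks k.+1 x s -> blocks k x (s + (i * p k)%N%:Z).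
Proof. by move=> /(blocksW (leqnSn k)); rewrite PoszM; exact: blocks_shift. Qed.

Lemma blocks_B {k x s} {i : nat} : blocks k.+1 x s -> i \in B k ->
  x (s + (i * p k)%N%:Z) = T ((b' k)%:Z * f k i) (x s).
Proof. by move=> /(_ k (ltnSn k) 0 i) []; rewrite mul0r addr0. Qed.

Lemma blocks_A {k x s} {i : nat} : blocks k.+1 x s -> i \in A k ->
  x (s + (i * p k)%N%:Z) = None.
Proof. by move=> /(_ k (ltnSn k) 0 i) [_]; rewrite mul0r addr0. Qed.

Lemma blocks_B_neq {k x s} {i : nat} : blocks k.+1 x s ->
  x s <> None -> i \in B k -> x (s + (i * p k)%N%:Z) <> None.
Proof. by move=> Hx xs iB; rewrite (blocks_B Hx iB) T_eq_None. Qed.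

(** A sub-block with index in [A k] starts with *, and one with index in [B k] starts with a power
    of [T] applied to *; induction applies to both. *)
Lemma star_block {k x s} {w : nat} :
  blocks k x s -> x s = None -> (w < p k)%N -> x (s + w%:Z) = None.
Proof.
elim: k w s => [|k IH] w s Hx xs.
  by rewrite /= ltnS leqn0 => /eqP ->; rewrite addr0.
move=> wp; have pk := p_gt0 k.
have -> : s + w%:Z = s + (w %/ p k * p k)%N%:Z + (w %% p k)%N%:Z.
  by rewrite -addrA -PoszD -divn_eq.
apply: IH; [exact: blocks_sub| |by rewrite ltn_mod].
have : (w %/ p k < n k)%N by rewrite ltn_divLR.
rewrite -mem_AB => /orP[iA|iB]; first exact: blocks_A.
by rewrite (blocks_B Hx iB) xs TNone.
Qed.

(** The last index [n l - 1] belongs to [B l] at every level. *)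
Lemma last_block {k l x s} : blocks l x s -> x s <> None ->
  (k <= l)%N -> x (s + (p l)%:Z - (p k)%:Z) <> None.
Proof.
elim: l s => [|l IH] s Hx xs.
  by rewrite leqn0 => /eqP ->; rewrite addrK.
rewrite leq_eqVlt => /predU1P[->|]; first by rewrite addrK.
rewrite ltnS => kl; have n4 := n_gt4 l.
have := IH _ (blocks_sub (n l - 1) Hx) (blocks_B_neq Hx xs (B_last C l)) kl.
by congr (x _ <> None); rewrite /= PoszM -subzn; last lia; ring.
Qed.

(* By (iii), a relative shift of the block decompositions would put a non-*
   sub-block of one point on top of a * sub-block of the other. *)
Lemma starts_aligned {k x y} {z r : int} :
  blocks k x z -> blocks k y r -> x z <> None ->
  (forall w : nat, (w < p k)%N -> x (z + w%:Z) = None <-> y (z + w%:Z) = None) ->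
  exists q : int, z = r + q * (p k)%:Z.
Proof.
elim: k => [|k IH] Hx Hy xz pat.
  by exists (z - r); rewrite mulr1 addrC subrK.
have n4 := n_gt4 k; have pk := p_gt0 k.
(* Induction aligns the starts modulo [p k]; it remains to show that the digit [i] of [q] modulo
   [n k] is 0. *)
have [||//|w wp|q zE] := IH.
- exact: blocksW Hx.
- exact: blocksW Hy.
- by apply: pat => /=; nia.
have := divz_eq q (n k)%:Z; have := modz_ge0 q (_ : (n k)%:Z != 0).
have := ltz_pmod q (_ : 0 < (n k)%:Z).
case: (q %% _)%Z => i; last by lia.
set q' := (q %/ _)%Z => /(_ ltac:(lia)) ilt _ qE.
have Hu : blocks k.+1 y (r + q' * (p k.+1)%:Z) by exact: blocks_shift.
have Hu' := blocks_shift _ _ _ 1 Hu.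
set u := r + _ in Hu Hu'.
have zu : z = u + (i * p k)%N%:Z by rewrite zE qE /u /= !PoszM; ring.
case: (posnP i) => [i0|i_gt0].
  by exists q'; rewrite zu i0 mul0n addr0.
have pat' (c : nat) : (c < n k)%N ->
    x (z + (c * p k)%N%:Z) = None <-> y (z + (c * p k)%N%:Z) = None.
  by move=> cn; apply: pat; rewrite /= ltn_pmul2r.
(* A small shift is compared with the block of [y] containing [z]; a large one becomes the small
   shift [n k - i] against the next block of [y], which starts at [u']. *)
exfalso; case: (leqP i.*2 (n k + 2)) => i2.
  have [c cA cB] := A_meets_B i_gt0 i2.
  have yu : y u <> None.
    move=> yu; apply: xz; have := pat' 0%N ltac:(lia).
    rewrite mul0n addr0 => ->; rewrite zu; apply: (star_block Hu yu).
    by rewrite /= ltn_pmul2r.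
  apply: (blocks_B_neq Hu yu cB); rewrite mulnDl addnC PoszD addrA -zu.
  by apply/(pat' _ (A_lt cA)); exact: blocks_A.
have [c cA cB] := @A_meets_B k (n k - i) ltac:(lia) ltac:(lia).
set u' := u + _ in Hu'.
have u'z : u' = z + ((n k - i) * p k)%N%:Z.
  by rewrite zu /u' /= mulnBl !PoszM -subzn; [ring|nia].
have yu' : y u' <> None.
  move=> yu'; apply: (blocks_B_neq Hx xz (B_last C k)).
  apply/pat'; first lia.
  have -> : (n k - 1 = (n k - i) + (i - 1))%N by lia.
  rewrite mulnDl PoszD addrA -u'z; apply: (star_block Hu' yu').
  by rewrite /= ltn_pmul2r; lia.
apply: (blocks_B_neq Hx xz cB); apply/pat'; first exact: B_lt.
by rewrite mulnDl addnC PoszD addrA -u'z; exact: blocks_A.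
Qed.

Lemma block_around (r t : int) {P : nat} : (0 < P)%N ->
  exists q : int, r + q * P%:Z <= t < r + q * P%:Z + P%:Z.
Proof.
move=> P0; exists ((t - r) %/ P%:Z)%Z.
have := divz_eq (t - r) P%:Z; have := @modz_ge0 (t - r) P%:Z ltac:(lia).
have := @ltz_pmod (t - r) P%:Z ltac:(lia).
by move: (_ %/ _)%Z (_ %% _)%Z => q c; lia.
Qed.

(** The level-[K] block of [x] around [t] is so long that its first or its last level-[k] block
    stays at distance at least [N] from [t], where [starts_aligned] applies. *)
Lemma offsets_aligned {x y t} {N k K : nat} {r r' : int} :
  x t <> None ->
  (forall j, N%:Z <= `|j - t| -> x j = None <-> y j = None) ->
  (N.*2 + (p k).*2 <= p K)%N -> blocks K x r ->
  blocks k y r' -> exists q : int, r = r' + q * (p k)%:Z.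
Proof.
move=> xt pat NK Hx Hy; have pk := p_gt0 k.
have pK := p_gt0 K.
have kK : (k <= K)%N.
  rewrite leqNgt; apply/negP => /ltnW Kk.
  by have := dvdn_leq pk (p_dvd Kk); lia.
have [q] := block_around r t pK; have {Hx} := blocks_shift _ _ _ q Hx.
have /dvdnP[c pE] := p_dvd kK.
set s := r + _ => Hx st.
have xs : x s <> None.
  move=> xs; apply: xt.
  have -> : t = s + (absz (t - s))%:Z by lia.
  by apply: (star_block Hx xs); lia.
have Hl : blocks k x (s + (p K)%:Z - (p k)%:Z).
  have -> : s + (p K)%:Z - (p k)%:Z = s + (c%:Z - 1) * (p k)%:Z.
    by rewrite pE PoszM; ring.
  exact/blocks_shift/(blocksW kK).
case: (lerP (s + (p k)%:Z + N%:Z) (t + 1)) => far.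
  have [w wp|q' sE] := starts_aligned (blocksW kK Hx) Hy xs _.
    by apply: pat; lia.
  exists (q' - q * c%:Z); rewrite mulrBl addrA -sE /s pE PoszM; ring.
have [w wp|q' sE] := starts_aligned Hl Hy (last_block Hx xs kK) _.
  by apply: pat; lia.
exists (q' - q * c%:Z - c%:Z + 1).
have -> : r = s + (p K)%:Z - (p k)%:Z - q * (p K)%:Z - (p K)%:Z + (p k)%:Z.
  by rewrite /s; ring.
by rewrite sE pE PoszM; ring.
Qed.

Lemma nested_blocks {x y t} {N : nat} :
  Yset X C x -> Yset X C y -> x t <> None ->
  (forall j, N%:Z <= `|j - t| -> x j = None <-> y j = None) ->
  exists (s : nat -> int) (i : nat -> nat), forall k,
  [/\ blocks k x (s k), blocks k y (s k),
      s k <= t < s k + (p k)%:Z, i k \in B k &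
      s k = s k.+1 + (i k * p k)%N%:Z].
Proof.
move=> Yx Yy xt pat.
(* The last clause makes the offset unique modulo [p k]; testing two consecutive levels against one
   common [r] then gives the nesting. *)
have /choice[s Hs] : forall k, exists s, [/\ blocks k x s,
    blocks k y s, s <= t < s + (p k)%:Z &
    forall (K : nat) r, (N.*2 + (p k).*2 <= p K)%N -> blocks K x r ->
      exists q : int, r = s + q * (p k)%:Z].
  move=> k; pose K := (N.*2 + (p k).*2)%N.
  have pK : (N.*2 + (p k).*2 <= p K.+1)%N by have := p_gt K.+1; lia.
  have kK : (k <= K.+1)%N by have := p_gt k; lia.
  have [r Hx] := Yset_blocks x Yx K; have [r' Hy] := Yset_blocks y Yy K.
  have [q rE] := offsets_aligned xt pat pK Hx (blocksW kK Hy).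
  have [q' sP] := block_around r t (p_gt0 k).
  have Hs : blocks k x (r + q' * (p k)%:Z).
    exact/blocks_shift/(blocksW kK).
  exists (r + q' * (p k)%:Z); split=> // [|L r2 pL Hr2].
    by rewrite rE -addrA -mulrDl; exact/blocks_shift/(blocksW kK).
  (* Here [x] is compared with itself, so the pattern condition is trivial. *)
  by apply: (offsets_aligned xt _ pL Hr2 Hs).
have /choice[i Hi] : forall k, exists i : nat,
    i \in B k /\ s k = s k.+1 + (i * p k)%N%:Z.
  move=> k; have [Hx _ st sk] := Hs k; have [HxS _ stS skS] := Hs k.+1.
  pose K := (N.*2 + (p k.+1).*2)%N.
  have pK : (N.*2 + (p k.+1).*2 <= p K.+1)%N.
    by have := p_gt K.+1; lia.
  have n4 := n_gt4 k; have pk := p_gt0 k.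
  have [r Hr] := Yset_blocks x Yx K.
  have [q1 E1] := skS _ _ pK Hr.
  have [q0 E0] := sk K.+1 r ltac:(move: pK => /=; nia) Hr.
  have sE : s k = s k.+1 + (q1 * (n k)%:Z - q0) * (p k)%:Z.
    have -> : s k = r - q0 * (p k)%:Z by rewrite E0 addrK.
    by rewrite E1 /= PoszM; ring.
  move: (q1 * _ - q0) sE stS => q sE; rewrite /= PoszM => stS.
  have q0' : 0 <= q by nia.
  have qn : q < (n k)%:Z by nia.
  case: q sE q0' qn => // i sE _ qn; exists i; rewrite PoszM; split=> //.
  have : (i < n k)%N by [].
  (* A digit in [A k] would make the whole level-[k] block *, including position [t]. *)
  rewrite -mem_AB => /orP[iA|//].
  have := blocks_A HxS iA; rewrite PoszM -sE => xs.
  exfalso; apply: xt; have -> : t = s k + (absz (t - s k))%:Z by lia.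
  by apply: (star_block Hx xs); lia.
exists s, i => k; have [? ? ? _] := Hs k; have [? ?] := Hi k; by split.
Qed.

(** * Exponents realised inside a block *)

(** Quantifying over all points lets one offset and exponent serve [x] and [y] simultaneously. *)
Definition displaces k (w : nat) (e : int) : Prop :=
  forall x s, blocks k x s -> x (s + w%:Z) = T e (x s).

Lemma displaces0 : displaces 0 0 0.
Proof. by move=> x s _; rewrite addr0. Qed.

Lemma displacesS {k} {i w : nat} {e : int} : i \in B k -> displaces k w e ->
  displaces k.+1 (i * p k + w) ((b' k)%:Z * f k i + e).
Proof.
move=> iB kwe x s Hx; rewrite PoszD addrA (kwe _ _ (blocks_sub i Hx)).
by rewrite (blocks_B Hx iB) -TD addrC.
Qed.

(** Leading digit of a mixed-radix expansion with non-positive digits: divide [absz e] by [b' k]. *)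
Lemma b'_digits {k} {e : int} : - (b' k.+1)%:Z < e <= 0 ->
  exists g e' : int, [/\ e = (b' k)%:Z * g + e', - ((b k)%:Z - 3) <= g <= 0 &
    - (b' k)%:Z < e' <= 0].
Proof.
rewrite b'S => eP; have b2 := b_gt2 k; have b0 := b'_gt0 k.
pose a := absz e; exists (- (a %/ b' k)%N%:Z), (- (a %% b' k)%N%:Z).
have aE := divn_eq a (b' k); have ltb := ltn_pmod a b0.
have ltq : (a %/ b' k < b k - 2)%N by rewrite ltn_divLR//; lia.
split; first by rewrite mulrN -opprD -PoszM -PoszD mulnC -aE /a; lia.
  by move: (a %/ _)%N ltq => q ltq; clear -ltq b2; lia.
by move: (a %% _)%N ltb => q ltb; clear -ltb; lia.
Qed.

Lemma displaces_onto {k} {e : int} : - (b' k)%:Z < e <= 0 ->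
  exists2 w : nat, (w < p k)%N & displaces k w e.
Proof.
elim: k e => [|k IH] e eP.
  have -> : e = 0 by move: eP => /=; lia.
  by exists 0%N => //; exact: displaces0.
have [g [e' [-> /f_onto[i [iB _ _ <-]] /IH[w wp kwe]]]] := b'_digits eP.
exists (i * p k + w)%N; last exact: displacesS.
by have := B_lt iB; rewrite /=; nia.
Qed.

(** * The nested blocks around a fixed position [t] *)

Section nested.
Variables (x y : seqs X) (t : int) (s : nat -> int) (i : nat -> nat).
Hypothesis blocks_x : forall k, blocks k x (s k).
Hypothesis blocks_y : forall k, blocks k y (s k).
Hypothesis s_t : forall k, s k <= t < s k + (p k)%:Z.
Hypothesis iB : forall k, i k \in B k.
Hypothesis sE : forall k, s k = s k.+1 + (i k * p k)%N%:Z.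

(** The power of [T] leading from the start of the level-[k] block to position [t]. *)
Fixpoint exponent k : int :=
  if k is j.+1 then (b' j)%:Z * f j (i j) + exponent j else 0.

Local Notation E := exponent.

Lemma exponent_displaces k : displaces k (absz (t - s k)) (E k).
Proof.
elim: k => [|k IH].
  by have -> : absz (t - s 0) = 0%N; [have /= := s_t 0; lia|exact: displaces0].
have -> : absz (t - s k.+1) = (i k * p k + absz (t - s k))%N.
  by have := sE k; have := s_t k; have := s_t k.+1; lia.
exact: displacesS.
Qed.

Lemma x_tE k : x t = T (E k) (x (s k)).
Proof.
rewrite -(exponent_displaces k) //; congr x; have := s_t k; lia.
Qed.

Lemma y_tE k : y t = T (E k) (y (s k)).
Proof.
rewrite -(exponent_displaces k) //; congr y; have := s_t k; lia.
Qed.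

Lemma exponent_bounds k : - (b' k)%:Z < E k <= 0.
Proof.
elim: k => //= k IH; have := f_bounds (iB k); have := b'S k => /= ->.
have := b_gt2 k; rewrite PoszM => b2.
have -> : (b k - 2)%N%:Z = (b k)%:Z - 2 by lia.
by move: IH (f k (i k)) => IH g gP; nia.
Qed.

(** Replacing the digit [i k] by another one with the same value of [f k] keeps the exponent and
    moves the position by at least [p k]. *)
Lemma repetition {k} :
  (f k (i k) == 0) || (f k (i k) == - ((b k)%:Z - 3)) ->
  exists j, [/\ (p k)%:Z <= `|j - t|, x j = x t & y j = y t].
Proof.
move=> /(f_extreme (iB k))[i' [i'B ne fE]].
have D := displacesS i'B (exponent_displaces k); rewrite fE in D.
exists (s k.+1 + (i' * p k + absz (t - s k))%N%:Z); split.
- have := sE k; have := s_t k.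
  have : (i' < i k)%N \/ (i k < i')%N by lia.
  have : ((i' < i k) -> (i' * p k + p k <= i k * p k))%N by nia.
  have : ((i k < i') -> (i k * p k + p k <= i' * p k))%N by nia.
  by rewrite !PoszM !PoszD; lia.
- by rewrite D// (x_tE k.+1).
- by rewrite D// (y_tE k.+1).
Qed.

Section interior.
Variable k0 : nat.
Hypothesis interior : forall k, (k0 <= k)%N ->
  - ((b k)%:Z - 3) < f k (i k) < 0.

Lemma interior_digit k : (k0 <= k)%N -> (0 < i k)%N /\ (i k + 1 < n k)%N.
Proof.
move=> /interior fi; have := B_lt (iB k); have n4 := n_gt4 k.
move: fi; rewrite /f_; case: eqP => [|i0]; first lia.
case: eqP => [|i1]; first lia.
by lia.
Qed.

(** Each interior digit moves the exponent at least 1 further from both ends of the window ([- b'],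
    0]; hence every [m] with [|m| <= d] is available at level [k0 + d]. *)
Lemma exponent_unbounded d :
  E (k0 + d) <= - d%:Z /\ d%:Z < E (k0 + d) + (b' (k0 + d))%:Z.
Proof.
elim: d => [|d [IH1 IH2]].
  by rewrite addn0; have := exponent_bounds k0; lia.
rewrite addnS b'S PoszM [E _.+1]/=; set k := (k0 + d)%N in IH1 IH2 *.
have := interior k (leq_addr _ _); have b0 := b'_gt0 k.
have -> : (b k - 2)%N%:Z = (b k)%:Z - 2 by have := b_gt2 k; lia.
by move: (f k (i k)) (E k) IH1 IH2 => g e *; nia.
Qed.

Lemma blocks_interior {k l : nat} : (k0 <= k)%N -> (k < l)%N ->
  s l + (p k)%:Z <= t /\ t + (p k)%:Z < s l + (p l)%:Z.
Proof.
move=> k0k; elim: l => // l IH; rewrite ltnS leq_eqVlt => /predU1P[<-|/IH].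
  have := interior_digit k k0k; have := sE k; have := s_t k.
  by rewrite /= !PoszM; nia.
by have := B_lt (iB l); have := sE l; rewrite /= !PoszM; nia.
Qed.

(* An exponent [m] first available at level [l + 1] is realised in a level-[l]
   block other than the one around [t], and [t] is at distance at least [p k]
   from the ends of the latter. *)
Lemma far_exponent {k l : nat} {m : int} : (k0 <= k)%N -> (k < l)%N ->
  - (b' l)%:Z < m + E l <= 0 ->
  - (b' k.+1)%:Z < m + E k.+1 <= 0 \/
  exists j, [/\ (p k)%:Z <= `|j - t|, x j = T m (x t) & y j = T m (y t)].
Proof.
move=> k0k; elim: l m => // l IH m; rewrite ltnS leq_eqVlt => /predU1P[<-|kl].
  by left.
move=> /b'_digits[g [e' [mE gP e'P]]].
(* Equal leading digits cancel, which lowers the level; distinct ones lead into another level-[l]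
   block. *)
have [gE|gne] := eqVneq g (f l (i l)).
  by apply: IH => //; move: mE; rewrite /= gE; lia.
right; have [i' [i'B _ _ fi']] := f_onto gP.
have ne : i' != i l by apply: contraNneq gne => <-; rewrite fi'.
have [w wp lwe] := displaces_onto e'P.
have D := displacesS i'B lwe; rewrite fi' -mE in D.
exists (s l.+1 + (i' * p l + w)%N%:Z); split.
- have [] := blocks_interior k0k kl; have := sE l.
  have : (i' < i l)%N \/ (i l < i')%N by lia.
  have : ((i' < i l) -> (i' * p l + p l <= i l * p l))%N by nia.
  have : ((i l < i') -> (i l * p l + p l <= i' * p l))%N by nia.
  by rewrite !PoszM !PoszD; lia.
- by rewrite D// TD -x_tE.
- by rewrite D// TD -y_tE.
Qed.

Lemma far_iterate {k : nat} {m : int} : (k0 <= k)%N ->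
  (b' k.+1)%:Z <= `|m| ->
  exists j, [/\ (p k)%:Z <= `|j - t|, x j = T m (x t) & y j = T m (y t)].
Proof.
move=> k0k mb; pose d := (k + absz m).+1.
have [dm dp] := exponent_unbounded d.
have kl : (k < k0 + d)%N by lia.
have [|h|//] := @far_exponent k (k0 + d) m k0k kl; first by lia.
(* Both [E k.+1] and [m + E k.+1] would lie in a window of [b' k.+1] integers, against the size of
   [m]. *)
by have := exponent_bounds k.+1; lia.
Qed.

End interior.
End nested.

(** * From asymptotic entries to an asymptotic pair in [X] *)

Lemma dstar_lt1 (u v : Xstar X) : dstar u v < 1 -> u = None <-> v = None.
Proof.
have h (w : X) : (diam X + 1 < 1) = false.
  have := mdist_le_diam w w (@tds_compact R X); rewrite mdistxx => dX.
  by apply/negbTE; rewrite -leNgt lerDr.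
by case: u v => [u|] [v|] //=; rewrite h.
Qed.

Lemma two_sided_asymptotic_entries {x y t} :
  Yset X C x -> Yset X C y -> x t <> None -> x t <> y t ->
  (forall e : R, 0 < e ->
     exists N : nat, forall j : int, N%:Z <= `|j| -> dstar (x j) (y j) < e) ->
  exists u v : X, u <> v /\
    two_sided_asymptotic mdist (@tds_map R X) (@tds_inv R X) u v.
Proof.
move=> Yx Yy xt xyt asym.
have asymt e : 0 < e ->
    exists N : nat, forall j, N%:Z <= `|j - t| -> dstar (x j) (y j) < e.
  by move=> /asym[N hN]; exists (N + absz t)%N => j hj; apply: hN; lia.
have [N /(_ _ _)/dstar_lt1 pat] := asymt 1 ltr01.
have [s [i Hs]] := nested_blocks Yx Yy xt pat.
have Hx k : blocks k x (s k) by case: (Hs k).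
have Hy k : blocks k y (s k) by case: (Hs k).
have st k : s k <= t < s k + (p k)%:Z by case: (Hs k).
have iB k : i k \in B k by case: (Hs k).
have sE k : s k = s k.+1 + (i k * p k)%N%:Z by case: (Hs k).
have yt : y t <> None.
  have [k kN] : exists k, (N.*2 < k)%N by exists N.*2.+1.
  have pk := p_gt k; have := st k.
  have xs : x (s k) <> None.
    by move=> xs; apply: xt; rewrite (x_tE _ _ _ _ Hx st iB sE k) xs TNone.
  rewrite (y_tE _ _ _ _ Hy st iB sE k) T_eq_None => skt ys.
  (* As [p k > 2 N], the first or the last entry of the block is at distance at least [N] from [t];
     there [x] is not * but [y] would be. *)
  have [far|near] := lerP N%:Z `|s k - t|; first by apply/xs/(pat _ far).
  have := last_block (Hx k) xs (leq0n k); apply.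
  apply/pat; first by rewrite /=; lia.
  rewrite -addrA subzn ?p_gt0//; apply: (star_block (Hy k) ys) => /=.
  by lia.
case xtE: (x t) xt xyt => [u|//] _; case ytE: (y t) yt => [v|//] _ uv.
exists u, v; split=> [E|]; first by rewrite E in uv.
have duv : 0 < mdist u v by rewrite mdist_gt0; apply/eqP => E; rewrite E in uv.
(* From level [k0] on, an extreme digit would repeat the pair ([u], [v]) where the entries are
   already closer than [mdist u v]. *)
have [k0 hk0] := asymt _ duv.
have interior k : (k0 <= k)%N -> - ((b k)%:Z - 3) < f k (i k) < 0.
  move=> k0k; have := f_bounds (iB k).
  suff : ~~ ((f k (i k) == 0) || (f k (i k) == - ((b k)%:Z - 3))) by lia.
  apply/negP => /(repetition _ _ _ _ _ Hx Hy st iB sE)[j [ej xj yj]].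
  have pk := p_gt k; have := hk0 j ltac:(lia).
  by rewrite xj yj xtE ytE /= ltxx.
have asymT e : 0 < e -> exists M : nat, forall m : int, M%:Z <= `|m| ->
    mdist (ziter (@tds_map R X) (@tds_inv R X) m u)
          (ziter (@tds_map R X) (@tds_inv R X) m v) < e.
  move=> /asymt[M hM]; exists (b' (maxn k0 M).+1) => m hm.
  have [j [ej xj yj]] :=
    far_iterate _ _ _ _ _ Hx Hy st iB sE k0 interior (leq_maxl k0 M) hm.
  have pk := p_gt (maxn k0 M); have := hM j ltac:(lia).
  by rewrite xj yj xtE ytE !TSome.
split; apply/cvgrPdist_lt => e /asymT[M hM]; exists M => // j Mj;
  rewrite sub0r normrN ger0_norm ?mdist_ge0//; apply: hM; move: Mj => /=; lia.
Qed.

End Structure.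

(** * Compactness and uniform control of coordinates *)

Section Coordinates.
Context {R : realType} {X : tds R}.

Lemma compact_Xstar : compact [set: Xstar X].
Proof.
have -> : [set: Xstar X] =
    (Some @` [set: X] : set (Xstar X)) `|` [set (None : Xstar X)].
  by apply/seteqP; split => [[u|]|//] _; [left; exists u|right].
apply: compactU; last exact: compact_set1.
apply: continuous_compact; last exact: tds_compact.
apply: continuous_subspaceT => u.
apply/metricType_numDomainType.cvgrPdist_lt => e e0.
exact: (@metricType_numDomainType.cvgr_dist_lt _ _ _ (nbhs u) _ id).
Qed.

Lemma compact_seqs : compact [set: seqs X].
Proof.
have := @tychonoff int (fun=> Xstar X) (fun=> setT) (fun=> compact_Xstar).
by congr compact; apply/seteqP; split.
Qed.

(** Uniform continuity of the coordinate at 0, obtained from compactness because [rho] is an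
    arbitrary compatible metric. *)
Lemma coordinate_uniform (rho : seqs X -> seqs X -> R) (e : R) :
  compatible_metric rho -> 0 < e ->
  exists2 c, 0 < c & forall x y : seqs X, rho x y < c -> dstar (x 0) (y 0) < e.
Proof.
move=> [rho0 rhoC rhoD rhoN] e0.
pose P (c : R) (x : seqs X) := forall y, rho x y < c -> dstar (x 0) (y 0) < e.
have /compact_near_coveringP/(_ _ (0 : R)^'+ P _) := compact_seqs.
move=> /(_ _)[].
  move=> x _.
  have nx : nbhs x [set y : seqs X | dstar (x 0) (y 0) < e / 2].
    have pc := @proj_continuous int (fun=> Xstar X) 0 x.
    have bx : nbhs (x 0) (ball (x 0 : Xstar X) (e / 2)).
      by apply: nbhsx_ballx; exact: divr_gt0.
    exact: (pc _ bx).
  have [c c0 hc] := (rhoN x _).1 nx.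
  (* Halving [c] keeps both [z] and [y] in the [c]-ball of [x]. *)
  exists ([set z | rho x z < c / 2], [set r | r < c / 2]) =>
    [|[z r] /= [xz rc] y zy].
    split; first by apply/rhoN; exists (c / 2) => //; exact: divr_gt0.
    by apply: nbhs_right_lt; exact: divr_gt0.
  have xy : rho x y < c by have := rhoD x z y; lra.
  have xz' : rho x z < c by have := divr_gt0 c0 (ltr0n R 2); lra.
  have := hc _ xy; have := hc _ xz' => /=.
  have := (@metric_triangle R (Xstar X) (z 0) (x 0) (y 0)).
  rewrite (@metric_sym R (Xstar X) (z 0) (x 0)) /mdist/=; lra.
move=> c /= c0 hc; exists (c / 2); first exact: divr_gt0.
move=> x y; apply: (hc (c / 2)) => //=; last exact: divr_gt0.
by rewrite sub0r normrN gtr0_norm ?divr_gt0//; lra.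
Qed.

Lemma two_sided_asymptotic_coordinates (rho : seqs X -> seqs X -> R)
    (x y : seqs X) :
  compatible_metric rho ->
  two_sided_asymptotic rho (@sigma R X) (@sigma_inv R X) x y ->
  forall e, 0 < e ->
  exists N : nat, forall j : int, N%:Z <= `|j| -> dstar (x j) (y j) < e.
Proof.
move=> hrho [xyp xyn] e e0.
have [c c0 hc] := coordinate_uniform rho e hrho e0.
have close (m : int) : `|rho (sigma_pow m x) (sigma_pow m y)| < c ->
    dstar (x m) (y m) < e.
  move=> h; have := hc _ _ (le_lt_trans (ler_norm _) h).
  by rewrite !sigma_powE !add0r.
have /cvgrPdist_lt/(_ c c0)[N1 _ h1] := xyp.
have /cvgrPdist_lt/(_ c c0)[N2 _ h2] := xyn.
exists (maxn N1 N2) => -[j|j] hj; apply: close.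
  by rewrite -normrN -sub0r; apply: (h1 j) => /=; lia.
by rewrite NegzE -normrN -sub0r; apply: (h2 j.+1) => /=; lia.
Qed.
End Coordinates.

Theorem proposition4p5 (R : realType) (X : tds R) (C : scheme R)
    (rho : seqs X -> seqs X -> R) :
  (forall x y : X, x <> y ->
     ~ two_sided_asymptotic mdist (@tds_map R X) (@tds_inv R X) x y) ->
  compatible_metric rho ->
  forall x y : seqs X, Yset X C x -> Yset X C y -> x <> y ->
    ~ two_sided_asymptotic rho (@sigma R X) (@sigma_inv R X) x y.
Proof.
move=> noasym hrho x y Yx Yy xy /(two_sided_asymptotic_coordinates _ _ _ hrho).
have main (x' y' : seqs X) t : Yset X C x' -> Yset X C y' -> x' t <> None ->
    x' t <> y' t -> ~ (forall e : R, 0 < e -> exists N : nat,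
      forall j : int, N%:Z <= `|j| -> dstar (x' j) (y' j) < e).
  move=> Yx' Yy' xt xyt /(two_sided_asymptotic_entries Yx' Yy' xt xyt).
  by move=> [u [v [uv]]]; exact: noasym.
have [t xyt] : exists t, x t <> y t.
  by apply/existsNP => E; apply: xy; apply/funext.
(* If [x t] is *, then [y t] is not, and the roles of [x] and [y] are exchanged. *)
case xt : (x t) => [u|]; first by apply: (main x y t) => //; rewrite xt.
move=> asym; apply: (main y x t) => // [|/esym//|e /asym[N hN]].
  by move=> yt; apply: xyt; rewrite xt yt.
exists N => j /hN; suff -> : dstar (x j) (y j) = dstar (y j) (x j) by [].
exact: (@metric_sym R (Xstar X)).
Qed.
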